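(* Let $L=L(\kappa,\tau,\kappa_s,\tau_s,\kappa_{ss},\tau_{ss},\dots)$ be a smooth function of finitely many arguments, and let $\mathbf{x}(s)=(x(s),y(s),z(s))^T$ be a space curve, parametrized by Euclidean arc length, that is an extremal of the one-dimensional $SE(3)$-invariant variational problem $\int L(\kappa,\tau,\kappa_s,\tau_s,\dots)\,\mathrm{d}s$. Let $\boldsymbol{\upsilon}(I)=(\upsilon^{(1)},\dots,\upsilon^{(6)})^T$, $D$, and the constant vectors $\mathbf{c}_1=(c_1,c_2,c_3)^T$, $\mathbf{c}_2=(c_4,c_5,c_6)^T$ of Noether's conservation laws be as in the context, and let $\widetilde{\mathbf{x}}=(\widetilde x,\widetilde y,\widetilde z)^T$ be the transformed curve described there, for which the conservation laws have the constant vector $\mathbf{C}$ on the right-hand side. Once $\kappa$ and $\tau$ are known, the extremal curve is obtained by quadratures as follows. (i) In cylindrical coordinates, $\widetilde{x}(s)=r(s)\cos\theta(s)$, $\widetilde{y}(s)=r(s)\sin\theta(s)$, with $$\widetilde{z}(s)=\frac{1}{|\mathbf{c}_1|}\int\upsilon^{(1)}\,\mathrm{d}s,\qquad r(s)^2=\int h(s)\,\mathrm{d}s-\widetilde{z}(s)^2,$$ $$h(s)=\mathcal{D}_s(\widetilde{\mathbf{x}}\cdot\widetilde{\mathbf{x}})=\upsilon^{(1)}\int\frac{1}{\upsilon^{(1)}}\left(\frac{2\kappa}{\upsilon^{(1)}}\left(\upsilon^{(6)}-\frac{\mathbf{c}_1^TD\mathbf{c}_2}{|\mathbf{c}_1|^2}\upsilon^{(3)}\right)+2\right)\mathrm{d}s,$$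 $$\theta(s)=\int\frac{1}{r(s)^2|\mathbf{c}_1|}\left(\upsilon^{(4)}-\frac{\mathbf{c}_1^TD\mathbf{c}_2}{|\mathbf{c}_1|^2}\upsilon^{(1)}\right)\mathrm{d}s.$$ (ii) The original curve is recovered by $\mathbf{x}=\mathsf{R}\widetilde{\mathbf{x}}+\mathbf{a}$, where $\mathsf{R}$ is the rotation $$\mathsf{R}=\begin{pmatrix}\cos\beta\cos\gamma&-\sin\alpha\sin\beta\cos\gamma-\cos\alpha\sin\gamma&-\cos\alpha\sin\beta\cos\gamma+\sin\alpha\sin\gamma\\ \cos\beta\sin\gamma&-\sin\alpha\sin\beta\sin\gamma+\cos\alpha\cos\gamma&-\cos\alpha\sin\beta\sin\gamma-\sin\alpha\cos\gamma\\ \sin\beta&\sin\alpha\cos\beta&\cos\alpha\cos\beta\end{pmatrix}$$ and $\mathbf{a}=(a,b,c)^T$ is the translation vector, with $$\alpha=-\tan^{-1}\left(\frac{\sqrt{|\mathbf{c}_1|^2\cos^2\beta-c_3^2}}{c_3}\right),\qquad \gamma=\tan^{-1}\left(\frac{c_2c_3\sin\beta+c_1\sqrt{|\mathbf{c}_1|^2\cos^2\beta-c_3^2}}{c_1c_3\sin\beta-c_2\sqrt{|\mathbf{c}_1|^2\cos^2\beta-c_3^2}}\right),$$ $$a=\frac{c_1}{c_3}c+\frac{c_5|\mathbf{c}_1|^2+c_2\,\mathbf{c}_1^TD\mathbf{c}_2}{c_3|\mathbf{c}_1|^2},\qquad b=\frac{c_2}{c_3}c+\frac{c_4|\mathbf{c}_1|^2-c_1\,\mathbf{c}_1^TD\mathbf{c}_2}{c_3|\mathbf{c}_1|^2},$$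 and where $\beta$ and $c$ are free.
   Context: Curves are space curves $\mathbf{x}(s)=(x(s),y(s),z(s))^T$ with $|\mathbf{x}_s|=1$; subscripts $s$ denote derivatives in $s$, and $\mathcal{D}_s=\mathrm{d}/\mathrm{d}s$. Curvature and torsion are $$\kappa=\frac{\|\mathbf{x}_s\times\mathbf{x}_{ss}\|}{\|\mathbf{x}_s\|^3},\qquad \tau=\frac{\mathbf{x}_{sss}\cdot(\mathbf{x}_s\times\mathbf{x}_{ss})}{\|\mathbf{x}_s\times\mathbf{x}_{ss}\|^2},$$ with $\kappa_m=\partial^m\kappa/\partial s^m$, $\tau_m=\partial^m\tau/\partial s^m$. The Euler operators are $\mathsf{E}^\kappa(L)=\sum_{m\ge0}(-1)^m\mathcal{D}_s^m(\partial L/\partial\kappa_m)$ and $\mathsf{E}^\tau(L)=\sum_{m\ge0}(-1)^m\mathcal{D}_s^m(\partial L/\partial\tau_m)$. All expressions in $L$ are evaluated along the curve. Put $$\lambda(s)=2\tau\mathsf{E}^\tau(L)-L+\sum_{m\ge1}\sum_{i=0}^{m-1}(-1)^i\mathcal{D}_s^i\left(\frac{\partial L}{\partial\kappa_m}\right)\kappa_{m-i}+\sum_{m\ge1}\sum_{i=0}^{m-1}(-1)^i\mathcal{D}_s^i\left(\frac{\partial L}{\partial\tau_m}\right)\tau_{m-i}.$$ The group $SE(3)$ acts on space by rotations and translations. An extremal curve is a curve that extremizes the functional $\int L\,\mathrm{d}s$. Along an extremal, Noether's conservation laws for the $SE(3)$-invariance read $$\begin{pmatrix}\rho_{FS}&\mathbf{0}\\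 DX\rho_{FS}&D\rho_{FS}D\end{pmatrix}\boldsymbol{\upsilon}(I)=\mathbf{c}=\begin{pmatrix}\mathbf{c}_1\\ \mathbf{c}_2\end{pmatrix},\qquad \boldsymbol{\upsilon}(I)=\begin{pmatrix}\upsilon^{(1)}\\ \upsilon^{(2)}\\ \upsilon^{(3)}\\ \upsilon^{(4)}\\ \upsilon^{(5)}\\ \upsilon^{(6)}\end{pmatrix}=\begin{pmatrix}\tau\mathsf{E}^\tau(L)-\kappa\mathsf{E}^\kappa(L)-\lambda(s)\\ -\mathcal{D}_s\mathsf{E}^\kappa(L)-\frac{\tau}{\kappa}\mathcal{D}_s\mathsf{E}^\tau(L)\\ \frac1\kappa\mathcal{D}_s^2\mathsf{E}^\tau(L)-\frac{\kappa_s}{\kappa^2}\mathcal{D}_s\mathsf{E}^\tau(L)+\kappa\mathsf{E}^\tau(L)-\tau\mathsf{E}^\kappa(L)\\ \mathsf{E}^\tau(L)\\ -\frac1\kappa\mathcal{D}_s\mathsf{E}^\tau(L)\\ \mathsf{E}^\kappa(L)\end{pmatrix},$$ with $\mathbf{c}_1,\mathbf{c}_2$ constant in $s$, where $\rho_{FS}=\left(\mathbf{x}_s\;\;\tfrac{\mathbf{x}_{ss}}{\kappa}\;\;\tfrac{\mathbf{x}_s\times\mathbf{x}_{ss}}{\kappa}\right)$ (columns), $D=\mathrm{diag}(1,-1,1)$ and $X=\begin{pmatrix}0&-z&y\\ z&0&-x\\ -y&x&0\end{pmatrix}$. This defines $\mathbf{c}_1$ and $\mathbf{c}_2$. For $g\in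 SE(3)$ with rotation $\mathsf{R}$ and translation $\mathbf{a}=(a,b,c)^T$, the Adjoint representation is $$\mathcal{A}d(g)=\begin{pmatrix}\mathsf{R}&\mathbf{0}\\ DA\mathsf{R}&D\mathsf{R}D\end{pmatrix},\qquad A=\begin{pmatrix}0&-c&b\\ c&0&-a\\ -b&a&0\end{pmatrix}.$$ One takes $g$ such that $\mathcal{A}d(g)^{-1}$ sends $\mathbf{c}$ to $$\mathbf{C}=\left(0,\,0,\,|\mathbf{c}_1|,\,0,\,0,\,\frac{\mathbf{c}_1^TD\mathbf{c}_2}{|\mathbf{c}_1|}\right)^T,$$ and $\widetilde{\mathbf{x}}$ is the correspondingly transformed curve, $\mathbf{x}=\mathsf{R}\widetilde{\mathbf{x}}+\mathbf{a}$; by equivariance of the moving frame, $\widetilde{\mathbf{x}}$ satisfies the conservation laws with $\mathbf{x}$ replaced by $\widetilde{\mathbf{x}}$ and $\mathbf{c}$ replaced by $\mathbf{C}$.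
   Formalization: The inverse tangents are taken in the correct quadrant: π is added for α when c₃cos β<0, and for γ when its denominator times cos β is positive; with principal values the claim fails (e.g. c₁ proportional to (0,−1,1), β=0). *)

(* Defs.v *)
From mathcomp Require Import all_boot all_order all_algebra.
From mathcomp Require Import all_classical all_reals all_analysis.

Set Implicit Arguments.
Unset Strict Implicit.
Unset Printing Implicit Defensive.

Import Order.TTheory GRing.Theory Num.Theory.
Import numFieldNormedType.Exports.

Local Open Scope classical_set_scope.
Local Open Scope ring_scope.

(* In ring_scope these notations would denote derivatives of polynomials. *)
Local Notation "f ^` ()" := (derive1 f) : ring_scope.
Local Notation "f ^` ( n )" := (derive1n n f) : ring_scope.

(** The library norm [`|v|] on matrices is the sup norm,
    hence the separate Euclidean norm [enorm]. *)

Section Space.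
Context {R : realType}.

(* 1-based coordinates, as in the usual notation (v_1, ..., v_n). *)
Definition entry n (v : 'cV[R]_n.+1) (k : nat) : R := v (inord k.-1) 0.

Definition vec3 (a b c : R) : 'cV[R]_3 := \col_(i < 3) [:: a; b; c]`_i.

Definition mat3 (rows : seq (seq R)) : 'M[R]_3 :=
  \matrix_(i < 3, j < 3) (nth [::] rows i)`_j.

Definition dot n (u v : 'cV[R]_n) : R := (u^T *m v) 0 0.

Definition enorm n (u : 'cV[R]_n) : R := Num.sqrt (dot u u).

(* The matrix X built from (x, y, z), and A built from (a, b, c). *)
Definition cross_mx (v : 'cV[R]_3) : 'M[R]_3 :=
  let x := entry v 1 in let y := entry v 2 in let z := entry v 3 in
  mat3 [:: [::   0; - z;   y ];
           [::   z;   0; - x ];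
           [:: - y;   x;   0 ] ].

(* cross_mx u *m v is the cross product u x v. *)
Definition cross (u v : 'cV[R]_3) : 'cV[R]_3 := cross_mx u *m v.

Definition Dmx : 'M[R]_3 :=
  mat3 [:: [:: 1;  0; 0 ];
           [:: 0; -1; 0 ];
           [:: 0;  0; 1 ] ].

Definition rotation (M : 'M[R]_3) : Prop := M^T *m M = 1%:M /\ \det M = 1.

(* The Adjoint representation of the rigid motion v |-> M *m v + a. The matrix
   of the conservation laws has the same shape, with M = rho_FS and a = x. *)
Definition Ad (M : 'M[R]_3) (a : 'cV[R]_3) : 'M[R]_(3 + 3) :=
  block_mx M 0 (Dmx *m cross_mx a *m M) (Dmx *m M *m Dmx).

Definition euler_rotation (al be ga : R) : 'M[R]_3 :=
  mat3 [:: [:: cos be * cos ga;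
               - sin al * sin be * cos ga - cos al * sin ga;
               - cos al * sin be * cos ga + sin al * sin ga ];
           [:: cos be * sin ga;
               - sin al * sin be * sin ga + cos al * cos ga;
               - cos al * sin be * sin ga - sin al * cos ga ];
           [:: sin be; sin al * cos be; cos al * cos be ] ].

(* A value of the inverse tangent at t: the principal one, or, if b, the one
   whose cosine is negative. *)
Definition arctan (b : bool) (t : R) : R := atan t + b%:R * pi.

End Space.

Section Calculus.
Context {R : realType}.

Definition smooth_curve (V : normedModType R) (I : set R) (x : R -> V) : Prop :=
  forall n s, I s -> derivable (x^`(n)) s 1.

(* C^k on the open set U, through iterated partial derivatives. *)
Fixpoint Ck m n (k : nat) (U : set 'M[R]_(m, n)) (f : 'M[R]_(m, n) -> R) : Prop :=
  (forall p, U p -> {for p, continuous f}) /\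
  if k is k'.+1 then
    forall i j,
      (forall p, U p -> derivable f p (delta_mx i j)) /\
      Ck k' U (fun p => 'D_(delta_mx i j) f p)
  else True.

Definition smooth_fun m n (U : set 'M[R]_(m, n)) (f : 'M[R]_(m, n) -> R) : Prop :=
  forall k, Ck k U f.

(* F is an indefinite integral of f on the interval I (the constant of
   integration is left free). *)
Definition indefinite_integral (I : set R) (f F : R -> R) : Prop :=
  forall s t, I s -> I t -> s <= t ->
    lebesgue_measure.-integrable `[s, t] (EFin \o f) /\
    F t - F s = \int[lebesgue_measure]_(u in `[s, t]) f u.

End Calculus.

(** The formulas for the curvature
    and the torsion are valid for an arbitrary regular parameter. *)

Section Curves.
Context {R : realType}.
Implicit Types (x y : R -> 'cV[R]_3).

Definition curvature x (s : R) : R :=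
  enorm (cross (x^`() s) (x^`(2) s)) / enorm (x^`() s) ^+ 3.

Definition torsion x (s : R) : R :=
  dot (x^`(3) s) (cross (x^`() s) (x^`(2) s))
  / enorm (cross (x^`() s) (x^`(2) s)) ^+ 2.

(* The columns of rho_FS; this is the Frenet frame when s is the arc length. *)
Definition rho_FS x (s : R) : 'M[R]_3 :=
  let x_s : 'cV[R]_3 := x^`() s in
  let x_ss : 'cV[R]_3 := x^`(2) s in
  let k := curvature x s in
  row_mx x_s (row_mx (k^-1 *: x_ss) (k^-1 *: cross x_s x_ss)).

Definition arclength_deriv y (f : R -> R) (u : R) : R :=
  f^`() u / enorm (y^`() u).

(* Argument of a Lagrangian of order N: row 0 contains kappa_0, ..., kappa_N
   and row 1 contains tau_0, ..., tau_N, where the m-th derivatives are taken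
   with the derivation ds. *)
Definition jet (N : nat) (ds : (R -> R) -> R -> R) x (s : R) : 'M[R]_(2, N.+1) :=
  \matrix_(i < 2, m < N.+1)
    iter m ds (if i == 0 then curvature x else torsion x) s.

End Curves.

Section Variational.
Context {R : realType} {N : nat}.
Variables (L : 'M[R]_(2, N.+1) -> R).
Implicit Types (x : R -> 'cV[R]_3).

(* The integral of L ds over the arc p <= u <= q, in an arbitrary parameter u;
   variations of an arc-length parametrized curve need not be parametrized by
   arc length. *)
Definition lagrangian_integral x (p q : R) : R :=
  \int[lebesgue_measure]_(u in `[p, q])
    (L (jet N (arclength_deriv x) x u) * enorm (x^`() u)).

Definition extremal (I : set R) x : Prop :=
  forall (p q : R) (phi : R -> 'cV[R]_3),
    I p -> I q -> p < q ->
    smooth_curve setT phi -> (forall u, u \notin `[p, q] -> phi u = 0) ->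
    is_derive (0 : R) 1
      (fun e => lagrangian_integral (fun u => x u + e *: phi u) p q) 0.

(** From here on x is parametrized by arc length s, and D_s = d/ds. *)

Definition sjet x (s : R) : 'M[R]_(2, N.+1) := jet N (fun f => f^`()) x s.

Definition dL_kappa (m : 'I_N.+1) x (s : R) : R := 'D_(delta_mx 0 m) L (sjet x s).
Definition dL_tau (m : 'I_N.+1) x (s : R) : R := 'D_(delta_mx 1 m) L (sjet x s).

Definition E_kappa x (s : R) : R :=
  \sum_(m < N.+1) (-1) ^+ m * (dL_kappa m x)^`(m) s.
Definition E_tau x (s : R) : R :=
  \sum_(m < N.+1) (-1) ^+ m * (dL_tau m x)^`(m) s.

Definition lambda x (s : R) : R :=
  2 * torsion x s * E_tau x s - L (sjet x s)
  + \sum_(m < N.+1 | (1 <= m)%N) \sum_(i < m)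
      (-1) ^+ i * (dL_kappa m x)^`(i) s * (curvature x)^`(m - i) s
  + \sum_(m < N.+1 | (1 <= m)%N) \sum_(i < m)
      (-1) ^+ i * (dL_tau m x)^`(i) s * (torsion x)^`(m - i) s.

Definition upsilon x (s : R) : 'cV[R]_(3 + 3) :=
  let k := curvature x s in
  let t := torsion x s in
  let Ek := E_kappa x in
  let Et := E_tau x in
  col_mx
    (vec3 (t * Et s - k * Ek s - lambda x s)
          (- Ek^`() s - t / k * Et^`() s)
          (k^-1 * Et^`(2) s - (curvature x)^`() s / k ^+ 2 * Et^`() s
             + k * Et s - t * Ek s))
    (vec3 (Et s)
          (- k^-1 * Et^`() s)
          (Ek s)).

(* c1 and c2 are the constant vectors of Noether's conservation laws. *)
Definition noether_laws (I : set R) x (c1 c2 : 'cV[R]_3) : Prop :=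
  forall s, I s -> Ad (rho_FS x s) (x s) *m upsilon x s = col_mx c1 c2.

End Variational.

Section Normalization.
Context {R : realType}.

(* C = (0, 0, |c1|, 0, 0, c1^T D c2 / |c1|)^T *)
Definition normalized_constants (c1 c2 : 'cV[R]_3) : 'cV[R]_(3 + 3) :=
  col_mx (vec3 0 0 (enorm c1)) (vec3 0 0 (dot c1 (Dmx *m c2) / enorm c1)).

(* The motion g = (M, a) is such that Ad(g)^-1 sends c to C, and xt is the
   correspondingly transformed curve. *)
Definition transformed_curve (I : set R) (x : R -> 'cV[R]_3)
    (c1 c2 : 'cV[R]_3) (M : 'M[R]_3) (a : 'cV[R]_3) (xt : R -> 'cV[R]_3) : Prop :=
  [/\ rotation M,
      invmx (Ad M a) *m col_mx c1 c2 = normalized_constants c1 c2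
    & forall s, I s -> x s = M *m xt s + a].

End Normalization.

(* Main.v *)
Require Import Defs.
From mathcomp Require Import all_boot all_order all_algebra.
From mathcomp Require Import all_classical all_reals all_analysis.
From mathcomp Require Import ring lra.

Import Order.TTheory GRing.Theory Num.Theory.
Import numFieldNormedType.Exports.

Local Open Scope classical_set_scope.
Local Open Scope ring_scope.

(** Let n = |c1| and mu = c1^T D c2 / n^2. For g = (M, a), the vector
    Ad(g)^-1 c is C exactly when M e_3 = c1 / n and a x c1 + mu c1 = D c2.
    The first half of the laws says that upsilon^(1), upsilon^(3) are the
    components of c1 along the tangent T and the binormal B; the second half,
    after subtraction of the moment of a, says that upsilon^(4), upsilon^(6)
    are the components of mu c1 - (x - a) x c1 along T and B. In the
    transformed frame this reads, writing y for the transformed curve,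
      upsilon^(1) = n y_3',
      upsilon^(4) - mu upsilon^(1) = n (y_1 y_2' - y_2 y_1'),
      upsilon^(6) - mu upsilon^(3) = n (y_1 B_2 - y_2 B_1).
    The first two identities are the quadratures of y_3 and of the polar angle;
    with h = 2 y . y' and h' = 2 + 2 y . y'', the third one computes the
    derivative of h / upsilon^(1). *)

(** * Space vectors and the Adjoint representation *)

Section SpaceVectors.
Set Implicit Arguments.
Unset Strict Implicit.
Context {R : realType}.
Implicit Types (u v w : 'cV[R]_3) (M : 'M[R]_3).

Lemma col3P u v : entry u 1 = entry v 1 -> entry u 2 = entry v 2 ->
  entry u 3 = entry v 3 -> u = v.
Proof.
move=> e1 e2 e3; apply/colP => i.
suff -> : i = inord i by case: i => [[|[|[|]]]].
by rewrite inord_val.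
Qed.

Lemma sum_inord3 (F : 'I_3 -> R) :
  \sum_i F i = F (inord 0) + F (inord 1) + F (inord 2).
Proof.
rewrite !big_ord_recl big_ord0 addr0 addrA.
by congr (F _ + F _ + F _); apply/val_inj; rewrite /= !inordK.
Qed.

(** Entries are numbered from 1, like those of [entry]. Together they reduce vector identities to
    polynomial ones in coordinates, which [ring] decides. *)
Definition ment (M : 'M[R]_3) (i j : nat) : R := M (inord i.-1) (inord j.-1).

Lemma entryE u k : u (inord k) 0 = entry u k.+1. Proof. by []. Qed.

Lemma entry_mulmx M u k :
  entry (M *m u) k =
  ment M k 1 * entry u 1 + ment M k 2 * entry u 2 + ment M k 3 * entry u 3.
Proof. by rewrite /entry mxE sum_inord3. Qed.

Lemma entry_vec3 (a b c : R) :
  (entry (vec3 a b c) 1 = a) * (entry (vec3 a b c) 2 = b) *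
  (entry (vec3 a b c) 3 = c).
Proof. by rewrite /entry !mxE !inordK. Qed.

Lemma ment_tr M i j : ment M^T i j = ment M j i.
Proof. by rewrite /ment mxE. Qed.

Lemma ment_mat3 rows i j : (0 < i <= 3)%N -> (0 < j <= 3)%N ->
  ment (mat3 rows : 'M[R]_3) i j = (nth [::] rows i.-1)`_j.-1.
Proof.
by case: i j => [|[|[|[|]]]] // [|[|[|[|]]]] // _ _; rewrite /ment mxE !inordK.
Qed.

Lemma entryD u v k : entry (u + v) k = entry u k + entry v k.
Proof. by rewrite /entry mxE. Qed.

Lemma entryN u k : entry (- u) k = - entry u k.
Proof. by rewrite /entry mxE. Qed.

Lemma entryZ (a : R) u k : entry (a *: u) k = a * entry u k.
Proof. by rewrite /entry mxE. Qed.

Lemma dotE u v :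
  dot u v =
  entry u 1 * entry v 1 + entry u 2 * entry v 2 + entry u 3 * entry v 3.
Proof. by rewrite /dot mxE sum_inord3 !mxE. Qed.

Lemma entry_cross u v :
  (entry (cross u v) 1 = entry u 2 * entry v 3 - entry u 3 * entry v 2) *
  (entry (cross u v) 2 = entry u 3 * entry v 1 - entry u 1 * entry v 3) *
  (entry (cross u v) 3 = entry u 1 * entry v 2 - entry u 2 * entry v 1).
Proof. by rewrite !entry_mulmx !ment_mat3//=; split; [split|]; ring. Qed.

Lemma entry_Dmx u :
  (entry (Dmx *m u) 1 = entry u 1) * (entry (Dmx *m u) 2 = - entry u 2) *
  (entry (Dmx *m u) 3 = entry u 3).
Proof. by rewrite !entry_mulmx !ment_mat3//=; split; [split|]; ring. Qed.

Lemma Dmx_mulK u : Dmx *m (Dmx *m u) = u.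
Proof. by apply: col3P; rewrite !entry_Dmx ?opprK. Qed.

Lemma DmxK : Dmx *m Dmx = 1%:M :> 'M[R]_3.
Proof.
apply/trmx_inj/row_matrixP => i; rewrite -!tr_col; congr trmx.
by rewrite !colE -mulmxA Dmx_mulK mul1mx.
Qed.

Lemma det_ment M : \det M =
  ment M 1 1 * (ment M 2 2 * ment M 3 3 - ment M 2 3 * ment M 3 2)
  - ment M 1 2 * (ment M 2 1 * ment M 3 3 - ment M 2 3 * ment M 3 1)
  + ment M 1 3 * (ment M 2 1 * ment M 3 2 - ment M 2 2 * ment M 3 1).
Proof.
(* As [f] takes natural numbers, the lifted ordinals produced by the two expansions compute to
   numerals. *)
pose f i j := M (inord i) (inord j).
have -> : \det M = \det (\matrix_(i < 3, j < 3) f i j).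
  by congr (\det _); apply/matrixP => i j; rewrite mxE /f !inord_val.
rewrite (expand_det_row _ ord0) !big_ord_recl big_ord0 /cofactor.
rewrite !(expand_det_row _ (ord0 : 'I_2)) !big_ord_recl !big_ord0 /cofactor.
rewrite !det_mx11 !mxE /= /bump /= !add0n !addn0.
rewrite /f /ment /= ?expr0 ?expr1 ?expr2 ?addn1.
ring.
Qed.

(** The cofactor matrix governs the effect of M on cross products; in this form it is a polynomial
    identity valid for every M. *)
Lemma tr_mul_cross M u v :
  M^T *m cross (M *m u) (M *m v) = \det M *: cross u v.
Proof.
by apply: col3P; rewrite entryZ entry_mulmx !ment_tr !entry_cross !entry_mulmx
  det_ment; ring.
Qed.

Lemma cross_mulmx M u v : rotation M ->
  cross (M *m u) (M *m v) = M *m cross u v.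
Proof.
move=> [oM dM]; rewrite -[LHS]mul1mx -(mulmx1C oM) -mulmxA tr_mul_cross.
by rewrite dM scale1r.
Qed.

Lemma dot_mulmx M u v : rotation M -> dot (M *m u) (M *m v) = dot u v.
Proof.
by move=> [oM _]; rewrite /dot trmx_mul -mulmxA (mulmxA M^T) oM mul1mx.
Qed.

Lemma rotation_tr M : rotation M -> rotation M^T.
Proof. by move=> [oM dM]; split; rewrite ?trmxK ?(mulmx1C oM)// det_tr. Qed.

Lemma dot_ge0 u : 0 <= dot u u.
Proof. by rewrite dotE !addr_ge0// -expr2 sqr_ge0. Qed.

Lemma enorm_sq u : enorm u ^+ 2 = dot u u.
Proof. by rewrite sqr_sqrtr// dot_ge0. Qed.

Lemma enorm_eq0 u : (enorm u == 0) = (u == 0).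
Proof.
rewrite sqrtr_eq0 le_eqVlt ltNge dot_ge0 orbF dotE -!expr2.
rewrite !paddr_eq0 ?addr_ge0 ?sqr_ge0// !sqrf_eq0.
apply/idP/eqP => [/andP[/andP[/eqP e1 /eqP e2] /eqP e3]|->].
  by apply: col3P; rewrite ?e1 ?e2 ?e3 /entry mxE.
by rewrite /entry !mxE eqxx.
Qed.

Lemma Ad_mul M u (v1 v2 : 'cV[R]_3) :
  Ad M u *m col_mx v1 v2 =
  col_mx (M *m v1) (Dmx *m cross u (M *m v1) + Dmx *m (M *m (Dmx *m v2))).
Proof. by rewrite /Ad mul_block_col mul0mx addr0 /cross !mulmxA. Qed.

Lemma Ad_unit M u : \det M = 1 -> Ad M u \in unitmx.
Proof.
move=> dM; rewrite unitmxE /Ad det_lblock !det_mulmx dM !mul1r mulr1 -det_mulmx.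
by rewrite DmxK det1 unitr1.
Qed.

(** Apply [Ad M u] to both sides and compare the two halves. The upper half is n M e_3 = c1. As D is
    an involution fixing e_3, multiplying the lower half by D and inserting the upper one gives the
    moment equation. *)
Lemma normalizedP M u (c1 c2 : 'cV[R]_3) : rotation M -> c1 != 0 ->
  (invmx (Ad M u) *m col_mx c1 c2 = normalized_constants c1 c2) <->
  (enorm c1 *: (M *m vec3 0 0 1) = c1 /\
   cross u c1 + (dot c1 (Dmx *m c2) / enorm c1 ^+ 2) *: c1 = Dmx *m c2).
Proof.
move=> [oM dM] c10.
have n0 : enorm c1 != 0 by rewrite enorm_eq0.
set mu := _ / _.
have e3 (a : R) : vec3 0 0 a = a *: vec3 0 0 1.
  by apply: col3P; rewrite entryZ !entry_vec3 ?mulr0 ?mulr1.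
have De3 : Dmx *m vec3 0 0 1 = vec3 0 0 1 :> 'cV[R]_3.
  by apply: col3P; rewrite !entry_Dmx !entry_vec3 ?oppr0.
have -> : invmx (Ad M u) *m col_mx c1 c2 = normalized_constants c1 c2 <->
    col_mx c1 c2 = Ad M u *m normalized_constants c1 c2.
  split=> [<-|->]; first by rewrite mulmxA mulmxV ?mul1mx// Ad_unit.
  by rewrite mulmxA mulVmx ?mul1mx// Ad_unit.
rewrite /normalized_constants Ad_mul e3 [vec3 _ _ (_ / _)]e3 -!scalemxAr De3.
have -> : dot c1 (Dmx *m c2) / enorm c1 = mu * enorm c1 by rewrite /mu; field.
rewrite -scalerA scalemxAr; split.
  move=> /eq_col_mx[E1]; rewrite -E1 => E2; split=> //.
  rewrite [in RHS]E2 mulmxDr !Dmx_mulK.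
  by rewrite -!scalemxAr Dmx_mulK scalemxAr -E1.
rewrite -scalemxAr => -[E1 E2]; rewrite E1; congr col_mx.
by rewrite -[LHS]Dmx_mulK -E2 mulmxDr -!scalemxAr -{2}E1 -scalemxAr.
Qed.

End SpaceVectors.

(** * Indefinite integrals and polar coordinates *)

Section Quadrature.
Set Implicit Arguments.
Unset Strict Implicit.
Context {R : realType} (I : set R).
Context (I_itv : is_interval I).
Implicit Types (f F g X Y dX dY : R -> R).

Lemma interval_segment s t : I s -> I t -> `[s, t] `<=` I.
Proof. by move=> Is It u /=; rewrite in_itv /= => /(I_itv Is It). Qed.

Lemma is_derive_continuous F (s d : R) : is_derive s 1 F d ->
  {for s, continuous F}.
Proof. by case=> dF _; exact/differentiable_continuous/derivable1_diffP. Qed.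

Lemma continuous_segment f s t : I s -> I t ->
  (forall u, I u -> {for u, continuous f}) -> {within `[s, t], continuous f}.
Proof.
move=> Is It cf; apply: continuous_in_subspaceT => u /[1!inE] ust.
exact/cf/(interval_segment Is It).
Qed.

Lemma segment_integrable f s t : I s -> I t ->
  (forall u, I u -> {for u, continuous f}) ->
  lebesgue_measure.-integrable `[s, t] (EFin \o f).
Proof.
move=> Is It cf; apply: continuous_compact_integrable.
  exact: segment_compact.
exact: continuous_segment.
Qed.

Lemma indefinite_integral_derive f F :
  (forall s, I s -> is_derive s 1 F (f s)) ->
  (forall s, I s -> {for s, continuous f}) -> indefinite_integral I f F.
Proof.
move=> dF cf s t Is It st; split; first exact: segment_integrable.
(* The fundamental theorem is applied for s < t; for s = t both sides are 0. *)
move: st; rewrite le_eqVlt => /predU1P[<-|st].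
  by rewrite set_itv1 Rintegral_set1 subrr.
have inI : `]s, t[ `<=` I.
  by apply: subset_trans (interval_segment Is It); exact: subset_itv_oo_cc.
rewrite /Rintegral (@continuous_FTC2 _ f F)//; first exact: continuous_segment.
  split.
  - by move=> u /inI /dF[].
  - exact/cvg_at_right_filter/(is_derive_continuous (dF _ Is)).
  - exact/cvg_at_left_filter/(is_derive_continuous (dF _ It)).
by move=> u /inI /dF[_ <-]; rewrite derive1E.
Qed.

(** Allows integrands to be exchanged by identities that hold only on I, such as the conservation
    laws. *)
Lemma indefinite_integral_eq f g F : {in I, f =1 g} ->
  indefinite_integral I f F -> indefinite_integral I g F.
Proof.
move=> fg iF s t Is It st; have [fi FE] := iF s t Is It st.
have fg' : {in `[s, t]%classic, f =1 g}.
  by move=> u /set_mem /(interval_segment Is It) Iu; rewrite fg ?inE.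
split; last by rewrite FE; exact: eq_Rintegral.
by apply: eq_integrable fi => // u /fg' /= ->.
Qed.

(** F is an indefinite integral of the zero function. *)
Lemma is_derive0_constant F s t : (forall u, I u -> is_derive u 1 F 0) ->
  I s -> I t -> F s = F t.
Proof.
move=> dF Is It.
have : indefinite_integral I (fun=> 0) F.
  by apply: indefinite_integral_derive => // u _; exact: cvg_cst.
have z A : \int[lebesgue_measure]_(u in A) (0 : R) = 0 :> R.
  by rewrite /Rintegral integral0.
move=> iF; have [st|/ltW ts] := leP s t; apply/eqP; rewrite eq_sym -subr_eq0.
  by rewrite (iF _ _ Is It st).2 z.
by rewrite -oppr_eq0 opprB (iF _ _ It Is ts).2 z.
Qed.

Context (I_open : open I).

Lemma open_left s : I s -> exists2 r, I r & r < s.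
Proof.
move=> /I_open[/= e e0 sub]; exists (s - e / 2).
  2: by rewrite ltrBlDr ltrDl divr_gt0.
by apply: sub; rewrite /ball /= opprB addrC subrK gtr0_norm ?divr_gt0//; lra.
Qed.

Lemma open_right s : I s -> exists2 r, I r & s < r.
Proof.
move=> /I_open[/= e e0 sub]; exists (s + e / 2); last by rewrite ltrDl divr_gt0.
apply: sub; rewrite /ball /= opprD addrA subrr sub0r normrN.
by rewrite gtr0_norm ?divr_gt0//; lra.
Qed.

(** An open interval has no least point, so no single lower end serves all s. F is the signed
    integral from a base point s0, written as a difference of two integrals with common lower end
    min(s, s0). *)
Lemma antiderivative f : (forall s, I s -> {for s, continuous f}) ->
  exists F, forall s, I s -> is_derive s 1 F (f s).
Proof.
move=> cf.
have [[s0 Is0]|nI] := pselect (exists s, I s); last first.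
  by exists (fun=> 0) => s Is; exfalso; apply: nI; exists s.
pose J a s := \int[lebesgue_measure]_(u in `[a, s]) f u.
pose F s := J (Num.min s s0) s - J (Num.min s s0) s0.
(* The difference does not depend on the common lower end. *)
have FE a s : I a -> I s -> a <= s -> a <= s0 -> F s = J a s - J a s0.
  move=> Ia Is as_ as0; rewrite /F; set m := Num.min s s0.
  have Im : I m by rewrite /m; case: (leP s s0).
  have am : a <= m by rewrite /m le_min as_.
  have split t : I t -> m <= t -> J a t = J a m + J m t.
    move=> It mt; apply/eqP; rewrite addrC -subr_eq; apply/eqP.
    rewrite /J (Rintegral_itvB (segment_integrable Ia It cf)) ?bnd_simp//.
    apply: Rintegral_itv_obnd_cbnd.
    apply: integrableS (segment_integrable Im It cf) => //.
    exact: subset_itv_oc_cc.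
  by rewrite (split s)// ?(split s0)// /m ?ge_min ?lexx ?orbT//; ring.
exists F => s Is.
have Im : I (Num.min s s0) by case: (leP s s0).
(* A lower end strictly left of both s and s0 can be frozen for all points near s, where the first
   fundamental theorem then applies. *)
have [a Ia] := open_left Im; rewrite lt_min => /andP[as_ as0].
have [b Ib sb] := open_right Is.
have [dJ J's] := @continuous_FTC1_closed R f a s b sb
  (segment_integrable Ia Ib cf) as_ (cf s Is).
apply: (@near_eq_is_derive _ _ _ (fun u => J a u - J a s0)).
  near=> u; rewrite (FE a)//.
  - near: u; exact: I_open.
  - apply/ltW; near: u; exact: lt_nbhsr.
  - exact: ltW.
have dJs : is_derive s 1 (J a) (f s) by split => //; rewrite -derive1E.
by apply: is_derive_eq; rewrite subr0.
Unshelve. all: by end_near. Qed.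

(** The angle [acos (x / r)] has the right cosine, and its sine is right up to sign; passing to the
    opposite angle corrects the sign. *)
Lemma polar_angle (x y : R) : 0 < x ^+ 2 + y ^+ 2 ->
  exists t, x = Num.sqrt (x ^+ 2 + y ^+ 2) * cos t /\
            y = Num.sqrt (x ^+ 2 + y ^+ 2) * sin t.
Proof.
set r := Num.sqrt _ => rho_gt0.
have r_gt0 : 0 < r by rewrite sqrtr_gt0.
have r_sq : r ^+ 2 = x ^+ 2 + y ^+ 2 by rewrite sqr_sqrtr// ltW.
have xr : -1 <= x / r <= 1.
  rewrite ler_pdivlMr// ler_pdivrMr// mulN1r mul1r -ler_norml.
  by rewrite -sqrtr_sqr ler_wsqrtr// lerDl sqr_ge0.
have cosE : x = r * cos (acos (x / r)) by rewrite acosK// mulrC divfK ?gt_eqF.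
have : (r * sin (acos (x / r))) ^+ 2 == y ^+ 2.
  rewrite -(inj_eq (addrI (x ^+ 2))) -r_sq {1}cosE !exprMn -mulrDr cos2Dsin2.
  by rewrite mulr1.
rewrite eqf_sqr => /orP[/eqP <-|/eqP sinE]; first by exists (acos (x / r)).
by exists (- acos (x / r)); rewrite cosN sinN mulrN sinE opprK.
Qed.

(** Pointwise angles need not vary continuously. Instead theta is an antiderivative of the angular
    speed w, adjusted at one point, and the unit vector (X, Y) / r is shown to be constant in the
    frame rotated by theta. *)
Lemma polar_lift X Y dX dY :
  (forall s, I s -> is_derive s 1 X (dX s)) ->
  (forall s, I s -> is_derive s 1 Y (dY s)) ->
  (forall s, I s -> {for s, continuous dX}) ->
  (forall s, I s -> {for s, continuous dY}) ->
  (forall s, I s -> 0 < X s ^+ 2 + Y s ^+ 2) ->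
  let r s : R := Num.sqrt (X s ^+ 2 + Y s ^+ 2) in
  exists theta,
    (forall s, I s -> X s = r s * cos (theta s) /\ Y s = r s * sin (theta s)) /\
    indefinite_integral I
      (fun s => (X s * dY s - Y s * dX s) / (X s ^+ 2 + Y s ^+ 2)) theta.
Proof.
move=> DX DY cdX cdY rho_gt0 r.
set w := fun s => _ / _.
have cX s : I s -> {for s, continuous X}.
  by move=> /DX; exact: is_derive_continuous.
have cY s : I s -> {for s, continuous Y}.
  by move=> /DY; exact: is_derive_continuous.
have cw s : I s -> {for s, continuous w}.
  move=> Is; have n0 := lt0r_neq0 (rho_gt0 s Is).
  apply: cvgM.
    by apply: cvgB; apply: cvgM; [exact: cX|exact: cdY|exact: cY|exact: cdX].
  apply: cvgV => //.
  by apply: cvgD; apply: cvgM; [exact: cX|exact: cX|exact: cY|exact: cY].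
have [T dT] := antiderivative cw.
have [[s0 Is0]|nI] := pselect (exists s, I s); last first.
  by exists T; split=> s; [|move=> t] => Is; exfalso; apply: nI; exists s.
have [t0 [Xt0 Yt0]] := polar_angle (rho_gt0 _ Is0).
(* The constant is chosen so that theta s0 = t0. *)
pose theta s := T s + (t0 - T s0).
have dtheta s : I s -> is_derive s 1 theta (w s).
  by move=> /dT dTs; apply: is_derive_eq; rewrite addr0.
exists theta; split; last exact: indefinite_integral_derive.
have r_gt0 s : I s -> 0 < r s by move=> Is; rewrite sqrtr_gt0 rho_gt0.
have r_sq s : I s -> r s ^+ 2 = X s ^+ 2 + Y s ^+ 2.
  by move=> Is; rewrite sqr_sqrtr// ltW// rho_gt0.
have dr s : I s -> is_derive s 1 (fun u => (r u)^-1)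
    (- (X s * dX s + Y s * dY s) / r s ^+ 3).
  move=> Is; have ? := DX _ Is; have ? := DY _ Is.
  have n0 := lt0r_neq0 (r_gt0 _ Is).
  have drho : is_derive s 1 (fun u => X u ^+ 2 + Y u ^+ 2)
      (2 * (X s * dX s + Y s * dY s)).
    apply: is_derive_eq; rewrite /GRing.scale /=; ring.
  have dr' : is_derive s 1 r ((X s * dX s + Y s * dY s) / r s).
    have dsqrt := is_derive1_sqrt (rho_gt0 _ Is).
    have dc := @is_derive1_comp R Num.sqrt (fun u => X u ^+ 2 + Y u ^+ 2)
      s _ _ dsqrt drho.
    by have := is_derive_eq dc _; apply; rewrite -/(r s); field.
  have := is_derive_eq (is_deriveV n0 dr') _; apply.
  by rewrite /GRing.scale /=; field.
(* The coordinates of (X, Y) / r in the frame rotated by theta. *)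
pose A s := (X s * cos (theta s) + Y s * sin (theta s)) * (r s)^-1.
pose B s := (Y s * cos (theta s) - X s * sin (theta s)) * (r s)^-1.
have dcos s : I s ->
  is_derive s 1 (fun u => cos (theta u)) (- sin (theta s) * w s).
  by move=> Is; exact: (@is_derive1_comp R cos theta s _ _ _ (dtheta _ Is)).
have dsin s : I s ->
  is_derive s 1 (fun u => sin (theta u)) (cos (theta s) * w s).
  by move=> Is; exact: (@is_derive1_comp R sin theta s _ _ _ (dtheta _ Is)).
have AB s : I s -> A s = 1 /\ B s = 0.
  move=> Is.
  have nr0 := lt0r_neq0 (r_gt0 _ Is0).
  have rX : X s0 = r s0 * cos t0 by [].
  have rY : Y s0 = r s0 * sin t0 by [].
  have A0 : A s0 = 1.
    by rewrite /A /theta subrKC rX rY -(cos2Dsin2 t0); field.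
  have B0 : B s0 = 0 by rewrite /B /theta subrKC rX rY; field.
  rewrite -A0 -B0; split; apply: is_derive0_constant => // u Iu;
    have ? := DX _ Iu; have ? := DY _ Iu;
    have ? := dcos _ Iu; have ? := dsin _ Iu;
    have ? := dr _ Iu; have n0 := lt0r_neq0 (r_gt0 _ Iu);
    apply: is_derive_eq; rewrite /GRing.scale /= /w -(r_sq u Iu).
    (* The derivative has the factor r^2 - (X^2 + Y^2), which vanishes; likewise for B. *)
    transitivity ((cos (theta u) * dX u + sin (theta u) * dY u)
      * (r u ^+ 2 - (X u ^+ 2 + Y u ^+ 2)) / r u ^+ 3); first by field.
    by rewrite r_sq// subrr mulr0 mul0r.
  transitivity ((cos (theta u) * dY u - sin (theta u) * dX u)
    * (r u ^+ 2 - (X u ^+ 2 + Y u ^+ 2)) / r u ^+ 3); first by field.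
  by rewrite r_sq// subrr mulr0 mul0r.
move=> s Is; have [A1 B0] := AB s Is; have n0 := lt0r_neq0 (r_gt0 _ Is).
have E1 : X s * cos (theta s) + Y s * sin (theta s) = r s.
  by apply: (mulIf (invr_neq0 n0)); rewrite -/(A s) A1 divff.
have E2 : Y s * cos (theta s) - X s * sin (theta s) = 0.
  by apply: (mulIf (invr_neq0 n0)); rewrite -/(B s) B0 mul0r.
(* Rotating the two components (r, 0) back by theta recovers (X, Y). *)
have cs := cos2Dsin2 (theta s); split.
  transitivity (X s * (cos (theta s) ^+ 2 + sin (theta s) ^+ 2)).
    by rewrite cs mulr1.
  by rewrite -E1 -[LHS]addr0 -(mulr0 (sin (theta s))) -E2; ring.
transitivity (Y s * (cos (theta s) ^+ 2 + sin (theta s) ^+ 2)).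
  by rewrite cs mulr1.
by rewrite -E1 -[RHS]addr0 -(mulr0 (cos (theta s))) -E2; ring.
Qed.

End Quadrature.

(** * Curves and their Frenet frame *)

Section Curves.
Set Implicit Arguments.
Unset Strict Implicit.
Context {R : realType}.
Local Notation "f ^` ()" := (derive1 f) : ring_scope.
Local Notation "f ^` ( n )" := (derive1n n f) : ring_scope.
Implicit Types (x y : R -> 'cV[R]_3) (M : 'M[R]_3) (v : 'cV[R]_3).

Lemma is_derive_entry y (s : R) k : derivable y s 1 ->
  is_derive s 1 (fun u => entry (y u) k) (entry (y^`() s) k).
Proof.
move=> dy; have dyk := (derivable_mxP y s 1).1 dy.
split; first exact: dyk.
by rewrite derive1E derive_mx// /entry mxE.
Qed.

Lemma is_derive_affine M v y (s : R) : derivable y s 1 ->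
  is_derive s 1 (fun u => M *m y u + v) (M *m y^`() s).
Proof.
move=> dy.
have dE i j : is_derive s 1 (fun u => (M *m y u + v) i j) ((M *m y^`() s) i j).
  rewrite (ord1 j); have d k := is_derive_entry k dy.
  have ? := d 1; have ? := d 2; have ? := d 3.
  have iE (w : 'cV[R]_3) : w i 0 = entry w i.+1 by rewrite -entryE inord_val.
  rewrite iE entry_mulmx.
  under [X in is_derive _ _ X _]funext => u do rewrite iE entryD entry_mulmx.
  by apply: is_derive_eq; rewrite /GRing.scale /=; ring.
have dMy : derivable (fun u => M *m y u + v) s 1.
  by apply/derivable_mxP => i j; case: (dE i j).
split=> //; rewrite derive_mx//; apply/matrixP => i j.
by rewrite mxE; case: (dE i j).
Qed.

Lemma is_derive_dot y z (s : R) : derivable y s 1 -> derivable z s 1 ->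
  is_derive s 1 (fun u => dot (y u) (z u))
    (dot (y^`() s) (z s) + dot (y s) (z^`() s)).
Proof.
move=> /is_derive_entry dy /is_derive_entry dz.
have ? := dy 1; have ? := dy 2; have ? := dy 3.
have ? := dz 1; have ? := dz 2; have ? := dz 3.
have -> : (fun u => dot (y u) (z u)) = (fun u => entry (y u) 1 * entry (z u) 1
    + entry (y u) 2 * entry (z u) 2 + entry (y u) 3 * entry (z u) 3).
  by apply/funext => u; rewrite dotE.
by apply: is_derive_eq; rewrite /GRing.scale /= !dotE; ring.
Qed.

(** Differentiate |x_s|^2 = 1, which holds on a neighbourhood of s since I is open. *)
Lemma arclength_perp (I : set R) x (s : R) : open I -> smooth_curve I x ->
  (forall s, I s -> enorm (x^`() s) = 1) -> I s -> dot (x^`() s) (x^`(2) s) = 0.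
Proof.
move=> oI sx x1 Is.
have dT : derivable (x^`()) s 1 := sx 1%N s Is.
have [_ d1] := is_derive_dot dT dT.
have [_ d2] : is_derive s 1 (fun u => dot (x^`() u) (x^`() u)) 0.
  apply: (@near_eq_is_derive R R R (fun=> 1)).
    near=> u; rewrite -enorm_sq x1 ?expr1n//; near: u; exact: oI.
have dotC (u v : 'cV[R]_3) : dot u v = dot v u by rewrite !dotE; ring.
move: d1; rewrite d2 [X in X + _]dotC -mulr2n => /esym/eqP.
by rewrite mulrn_eq0 /= => /eqP.
Unshelve. all: by end_near. Qed.

Lemma row_mx3E (u v w : 'cV[R]_3) i :
  let A : 'M[R]_3 := row_mx u (row_mx v w) in
  (A i (inord 0) = u i 0) * (A i (inord 1) = v i 0) * (A i (inord 2) = w i 0).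
Proof.
have o0 : inord 0 = lshift 2 0 :> 'I_(1 + (1 + 1)).
  by apply/val_inj; rewrite /= inordK.
have o1 : inord 1 = rshift 1 (lshift 1 0) :> 'I_(1 + (1 + 1)).
  by apply/val_inj; rewrite /= inordK.
have o2 : inord 2 = rshift 1 (rshift 1 0) :> 'I_(1 + (1 + 1)).
  by apply/val_inj; rewrite /= inordK.
rewrite /= o0 o1 o2; split; [split|].
- exact: row_mxEl.
- by etransitivity; [exact: row_mxEr|exact: row_mxEl].
- by etransitivity; [exact: row_mxEr|exact: row_mxEr].
Qed.

Lemma rho_FS_mul x (s : R) v : rho_FS x s *m v =
  entry v 1 *: x^`() s + (entry v 2 / curvature x s) *: x^`(2) s
  + (entry v 3 / curvature x s) *: cross (x^`() s) (x^`(2) s).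
Proof.
apply/colP => i; rewrite mxE sum_inord3 !entryE /rho_FS !row_mx3E !mxE; ring.
Qed.

(** The first column is a unit vector orthogonal to the other two. *)
Lemma dot_rho_FS_tangent x (s : R) v : enorm (x^`() s) = 1 ->
  dot (x^`() s) (x^`(2) s) = 0 -> dot (rho_FS x s *m v) (x^`() s) = entry v 1.
Proof.
move=> t1 tp; rewrite rho_FS_mul.
have tt : dot (x^`() s) (x^`() s) = 1 by rewrite -enorm_sq t1 expr1n.
transitivity (entry v 1 * dot (x^`() s) (x^`() s)
  + entry v 2 / curvature x s * dot (x^`() s) (x^`(2) s)).
  by rewrite !dotE !(entryD, entryZ) !entry_cross; ring.
by rewrite tt tp mulr0 addr0 mulr1.
Qed.

(** The pairing is with the unnormalized binormal, whose length is the curvature; hence the factor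
    on the right. *)
Lemma dot_rho_FS_binormal x (s : R) v : enorm (x^`() s) = 1 ->
  curvature x s != 0 ->
  dot (rho_FS x s *m v) (cross (x^`() s) (x^`(2) s)) =
  curvature x s * entry v 3.
Proof.
move=> t1 k0; rewrite rho_FS_mul.
have kk : dot (cross (x^`() s) (x^`(2) s)) (cross (x^`() s) (x^`(2) s))
    = curvature x s ^+ 2.
  by rewrite -enorm_sq /curvature t1 expr1n divr1.
transitivity (entry v 3 / curvature x s *
  dot (cross (x^`() s) (x^`(2) s)) (cross (x^`() s) (x^`(2) s))).
  by rewrite !dotE !(entryD, entryZ) !entry_cross; ring.
by rewrite kk; field.
Qed.

Lemma entry_col_mx (u v : 'cV[R]_3) k : (k < 3)%N ->
  (entry (col_mx u v) k.+1 = entry u k.+1) *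
  (entry (col_mx u v) (3 + k).+1 = entry v k.+1).
Proof.
move=> k3; rewrite /entry [k.+1.-1]/= [(3 + k).+1.-1]/=; split.
  have -> : inord k = lshift 3 (inord k : 'I_3).
    by apply: ord_inj; rewrite /= !inordK// (leq_trans k3).
  exact: col_mxEu.
have -> : inord (3 + k) = rshift 3 (inord k : 'I_3).
  by apply: ord_inj; rewrite /= !inordK.
exact: col_mxEd.
Qed.

(** On I the hypothesis gives y = M^T (x - v). As I is open, this formula holds near s and can be
    differentiated there, repeatedly by induction. *)
Lemma transformed_derive (I : set R) x y (c1 c2 : 'cV[R]_3) M v n (s : R) :
  open I -> smooth_curve I x -> transformed_curve I x c1 c2 M v y -> I s ->
  is_derive s 1 (y^`(n)) (M^T *m x^`(n.+1) s).
Proof.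
move=> oI sx [[oM _] _ xy]; elim: n s => [|n IH] s Is.
  apply: (@near_eq_is_derive _ _ _ (fun u => M^T *m x u + - (M^T *m v))).
    near=> u; rewrite xy; last by near: u; exact: oI.
    by rewrite mulmxDr mulmxA oM mul1mx addrK.
  exact: is_derive_affine (sx 0%N s Is).
apply: (@near_eq_is_derive _ _ _ (fun u => M^T *m x^`(n.+1) u + 0)).
  near=> u; have Iu : I u by near: u; exact: oI.
  by have [_ <-] := IH u Iu; rewrite addr0 derive1nS derive1E.
exact: is_derive_affine (sx n.+1 s Is).
Unshelve. all: by end_near. Qed.

End Curves.

(** * The conservation laws in the transformed frame *)

Section Transformed.
Set Implicit Arguments.
Unset Strict Implicit.
Context {R : realType}.
Local Notation "f ^` ()" := (derive1 f) : ring_scope.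
Local Notation "f ^` ( n )" := (derive1n n f) : ring_scope.

(** Both halves of the laws are paired with x_s and with x_s x x_ss, then expressed in the
    transformed frame, where c1 becomes n e_3. The curvature in the third identity appears because B
    is not normalized. *)
Lemma transformed_noether (I : set R) (x y : R -> 'cV[R]_3) (c1 c2 : 'cV[R]_3)
    (M : 'M[R]_3) (a : 'cV[R]_3) (ups : 'cV[R]_(3 + 3)) (s : R) :
  open I -> smooth_curve I x -> (forall s, I s -> enorm (x^`() s) = 1) ->
  c1 != 0 -> transformed_curve I x c1 c2 M a y -> I s -> curvature x s != 0 ->
  Ad (rho_FS x s) (x s) *m ups = col_mx c1 c2 ->
  let mu := dot c1 (Dmx *m c2) / enorm c1 ^+ 2 in
  let w := y s in
  let T := y^`() s in
  let B := cross T (y^`(2) s) in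
  [/\ entry ups 1 = enorm c1 * entry T 3,
      entry ups 4 - mu * entry ups 1
        = enorm c1 * (entry w 1 * entry T 2 - entry w 2 * entry T 1)
    & curvature x s * (entry ups 6 - mu * entry ups 3)
        = enorm c1 * (entry w 1 * entry B 2 - entry w 2 * entry B 1)].
Proof.
move=> oI sx x1 c10 tc Is k0 law mu w T B.
have [rM nC xy] := tc.
have tp := arclength_perp oI sx x1 Is.
have t1 := x1 s Is.
have [_ /=] := transformed_derive 0 oI sx tc Is; rewrite -derive1E => yT.
have [_ /=] := transformed_derive 1 oI sx tc Is; rewrite -derive1E => yP.
have MM : M *m M^T = 1%:M by case: rM => /mulmx1C.
have Tx : x^`() s = M *m T by rewrite /T yT mulmxA MM mul1mx.
have Px : x^`(2) s = M *m y^`(2) s.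
  by rewrite [y^`(2) s]yP mulmxA MM mul1mx.
have Bx : cross (x^`() s) (x^`(2) s) = M *m B by rewrite Tx Px cross_mulmx.
have [/esym c1E c2E] := (normalizedP a c2 rM c10).1 nC.
(* From here c1 = M e, where e has coordinates (0, 0, n). *)
rewrite scalemxAr in c1E; set e := _ *: vec3 _ _ _ in c1E.
have eE : ((entry e 1 = 0) * (entry e 2 = 0) * (entry e 3 = enorm c1))%type.
  by rewrite /e !entryZ !entry_vec3 !mulr0 mulr1.
clearbody e; set n := enorm c1 in eE *.
move: law; rewrite -[ups]vsubmxK; set ua := usubmx ups; set ub := dsubmx ups.
rewrite Ad_mul => /eq_col_mx[law1]; rewrite law1 => law2.
rewrite !(entry_col_mx ua ub (isT : (0 < 3)%N)).
rewrite !(entry_col_mx ua ub (isT : (2 < 3)%N)).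
(* Subtracting the two expressions of D c2 removes the moment of a. *)
have Pb : rho_FS x s *m (Dmx *m ub) = mu *: c1 - cross (M *m w) c1.
  have : cross (x s) c1 + rho_FS x s *m (Dmx *m ub) = cross a c1 + mu *: c1.
    by rewrite c2E -law2 mulmxDr !Dmx_mulK.
  have -> : cross (x s) c1 = cross (M *m w) c1 + cross a c1.
    by rewrite xy// /cross; apply: col3P;
      rewrite !(entryD, entry_cross); ring.
  by move=> /(congr1 (fun v => v - cross (M *m w) c1 - cross a c1)) E;
    apply: col3P; move: E =>
    /(congr1 (fun v => (entry v 1, entry v 2, entry v 3)));
    rewrite !(entryD, entryN, entryZ) => -[E1 E2 E3]; lra.
have {}Pb : rho_FS x s *m (Dmx *m ub) = M *m (mu *: e - cross w e).
  (* With c1 = M e the rotation factors out, leaving an expression in the transformed frame. *)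
  by rewrite Pb c1E cross_mulmx// mulmxBr scalemxAr.
have ua1 := dot_rho_FS_tangent ua t1 tp.
have ua3 := dot_rho_FS_binormal ua t1 k0.
have := dot_rho_FS_tangent (Dmx *m ub) t1 tp.
have := dot_rho_FS_binormal (Dmx *m ub) t1 k0.
move: ua1 ua3; rewrite law1 Pb Bx Tx c1E !dot_mulmx//.
(* D changes only the second sign, so the pairings return the first and third entries of [ub],
   namely upsilon^(4) and upsilon^(6), unchanged. *)
rewrite !dotE !(entryD, entryN, entryZ) !entry_cross !eE !entry_Dmx.
move=> <- ua3 ub3 <-; split; try ring.
by rewrite mulrBr mulrCA -ub3 -ua3; ring.
Qed.

End Transformed.

(** * Euler angles *)

Section EulerAngles.
Set Implicit Arguments.
Unset Strict Implicit.
Context {R : realType}.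

Lemma euler_rotation_rotation (al be ga : R) :
  rotation (euler_rotation al be ga).
Proof.
have ca := cos2Dsin2 al; have cb := cos2Dsin2 be; have cg := cos2Dsin2 ga.
(* Rewriting squared sines lets [ring] decide the entries modulo the three Pythagorean relations. *)
have sa2 : sin al ^+ 2 = 1 - cos al ^+ 2 by rewrite -ca; ring.
have sb2 : sin be ^+ 2 = 1 - cos be ^+ 2 by rewrite -cb; ring.
have sg2 : sin ga ^+ 2 = 1 - cos ga ^+ 2 by rewrite -cg; ring.
split; last first.
  rewrite det_ment /euler_rotation !ment_mat3//=.
  by ring: sa2 sb2 sg2.
apply/matrixP => i j; rewrite mxE sum_inord3 !mxE !inordK//.
by case: i j => [[|[|[|]]]] // ? [[|[|[|]]]] // ?;
  rewrite /=; ring: sa2 sb2 sg2.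
Qed.

(** The principal value has the positive cosine |q / m|; the flag selects the other branch exactly
    when q / m < 0. The sine follows from the tangent. Here m may be either square root of p^2 +
    q^2. *)
Lemma cos_sin_arctan (b : bool) (p q m : R) : q != 0 -> m != 0 ->
  m ^+ 2 = p ^+ 2 + q ^+ 2 -> b = (q * m < 0) ->
  cos (arctan b (p / q)) = q / m /\ sin (arctan b (p / q)) = p / m.
Proof.
move=> q0 m0 mE bE.
have cE : cos (arctan b (p / q)) = q / m.
  have -> : cos (arctan b (p / q)) = (-1) ^+ b * cos (atan (p / q)).
    rewrite /arctan; case: b {bE}.
      by rewrite mul1r cosDpi expr1 mulN1r.
    by rewrite mul0r addr0 expr0 mul1r.
  rewrite cos_atan.
  have -> : 1 + (p / q) ^+ 2 = (m / q) ^+ 2 by rewrite !expr_div_n mE; field.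
  rewrite sqrtr_sqr -normfV invfM invrK bE mulrC.
  have m2 : 0 < m ^- 2 by rewrite invr_gt0 exprn_even_gt0.
  have qmE : m^-1 * q = q * m * m ^- 2 by field.
  rewrite [q / m]mulrC qmE; have [qm|qm] := ltrP (q * m) 0.
    have neg : q * m * m ^- 2 < 0 by rewrite pmulr_llt0.
    by rewrite (ltr0_norm neg); ring.
  by rewrite mulr1 ger0_norm// mulr_ge0// ltW.
split=> //.
have t0 : cos (atan (p / q)) != 0.
  by rewrite gt_eqF// cos_atan invr_gt0 sqrtr_gt0 ltr_pwDl ?sqr_ge0.
have : tan (arctan b (p / q)) = p / q.
  rewrite /arctan; case: b {bE cE}; rewrite ?mul1r ?mul0r ?addr0 ?atanK//.
  by rewrite /tan sinDpi cosDpi invrN mulrNN -/(tan _) atanK.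
rewrite /tan cE => /(congr1 ( *%R^~ (q / m))); rewrite -mulrA mulVf ?mulr1.
  by move=> ->; field; rewrite q0 m0.
by rewrite mulf_neq0// invr_neq0.
Qed.

Lemma euler_rotation_axis (be n c1 c2 c3 : R) :
  let root := Num.sqrt (n ^+ 2 * cos be ^+ 2 - c3 ^+ 2) in
  let num := c2 * c3 * sin be + c1 * root in
  let den := c1 * c3 * sin be - c2 * root in
  n ^+ 2 = c1 ^+ 2 + c2 ^+ 2 + c3 ^+ 2 -> 0 < n ->
  c3 != 0 -> 0 <= n ^+ 2 * cos be ^+ 2 - c3 ^+ 2 -> den != 0 ->
  let al := - arctan (c3 * cos be < 0) (root / c3) in
  let ga := arctan (0 < den * cos be) (num / den) in
  n *: (euler_rotation al be ga *m vec3 0 0 1) = vec3 c1 c2 c3.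
Proof.
move=> root num den n2 n_gt0 c30 disc_ge0 den0 al ga.
have root2 : root ^+ 2 = n ^+ 2 * cos be ^+ 2 - c3 ^+ 2 by rewrite sqr_sqrtr.
have cb0 : cos be != 0.
  apply: contraNneq c30 => cb; move: disc_ge0; rewrite cb expr0n mulr0 sub0r.
  by rewrite oppr_ge0 le_eqVlt ltNge sqr_ge0 orbF sqrf_eq0.
have n0 := lt0r_neq0 n_gt0.
pose rho := c1 ^+ 2 + c2 ^+ 2.
have rho_gt0 : 0 < rho.
  rewrite lt_def addr_ge0 ?sqr_ge0// andbT; apply: contraNneq den0 => /eqP.
  rewrite paddr_eq0 ?sqr_ge0// !sqrf_eq0 => /andP[/eqP c10 /eqP c20].
  by rewrite /den c10 c20 !mul0r subrr.
have [cal sal] :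
    cos (arctan (c3 * cos be < 0) (root / c3)) = c3 / (n * cos be) /\
    sin (arctan (c3 * cos be < 0) (root / c3)) = root / (n * cos be).
  apply: cos_sin_arctan => //; first exact: mulf_neq0.
    by rewrite root2; ring.
  by rewrite mulrCA (pmulr_rlt0 _ n_gt0).
have sb2 : sin be ^+ 2 = 1 - cos be ^+ 2 by rewrite -(cos2Dsin2 be); ring.
(* One has num^2 + den^2 = (rho cos be)^2. The negative root is the one for which the third column
   yields c1 and c2 rather than their opposites. *)
have [cga sga] :
    cos ga = den / - (rho * cos be) /\
    sin ga = num / - (rho * cos be).
  apply: cos_sin_arctan => //; first by rewrite oppr_eq0 mulf_neq0// gt_eqF.
    transitivity (rho * (c3 ^+ 2 * sin be ^+ 2 + root ^+ 2)).
      by rewrite root2 sb2 n2 /rho; ring.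
    by rewrite /den /num /rho; ring.
  by rewrite mulrN oppr_lt0 mulrCA (pmulr_rgt0 _ rho_gt0).
have rho0 := lt0r_neq0 rho_gt0.
apply: col3P;
  rewrite entryZ entry_mulmx !entry_vec3 !ment_mat3//= cosN sinN cal sal.
- rewrite cga sga.
  transitivity (c1 * (c3 ^+ 2 * sin be ^+ 2 + root ^+ 2) / (rho * cos be ^+ 2)).
    by rewrite /num /den; field; rewrite cb0 rho0 n0.
  have -> : c3 ^+ 2 * sin be ^+ 2 + root ^+ 2 = rho * cos be ^+ 2.
    by rewrite root2 sb2 n2 /rho; ring.
  by field; rewrite cb0 rho0.
- rewrite cga sga.
  transitivity (c2 * (c3 ^+ 2 * sin be ^+ 2 + root ^+ 2) / (rho * cos be ^+ 2)).
    by rewrite /num /den; field; rewrite cb0 rho0 n0.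
  have -> : c3 ^+ 2 * sin be ^+ 2 + root ^+ 2 = rho * cos be ^+ 2.
    by rewrite root2 sb2 n2 /rho; ring.
  by field; rewrite cb0 rho0.
- by field; rewrite cb0 n0.
Qed.

End EulerAngles.

(** * Integration by quadratures *)

Theorem mainTheorem5 (R : realType) (N : nat)
    (U : set 'M[R]_(2, N.+1)) (L : 'M[R]_(2, N.+1) -> R)
    (I : set R) (x : R -> 'cV[R]_3) (c1 c2 : 'cV[R]_3)
    (U_open : open U) (L_smooth : smooth_fun U L)
    (I_open : open I) (I_interval : is_interval I)
    (x_smooth : smooth_curve I x)
    (x_arclength : forall s, I s -> enorm (x^`()%classic s) = 1)
    (x_curved : forall s, I s -> curvature x s != 0)
    (x_domain : forall s, I s -> U (sjet x s))
    (x_extremal : extremal L I x)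
    (x_noether : noether_laws L I x c1 c2)
    (c1_neq0 : c1 != 0) :
  let ups1 s := entry (upsilon L x s) 1 in
  let ups3 s := entry (upsilon L x s) 3 in
  let ups4 s := entry (upsilon L x s) 4 in
  let ups6 s := entry (upsilon L x s) 6 in
  let kappa := curvature x in
  let c1Dc2 := dot c1 (Dmx *m c2) in
  (* (i) *)
  (forall (M : 'M[R]_3) (a : 'cV[R]_3) (xt : R -> 'cV[R]_3),
     transformed_curve I x c1 c2 M a xt ->
     let h := (fun s => dot (xt s) (xt s))^`()%classic in
     [/\ (exists2 Z : R -> R, indefinite_integral I (ups1) Z &
            forall s, I s -> entry (xt s) 3 = (enorm c1)^-1 * Z s),
         ((forall s, I s -> ups1 s != 0) ->
          exists2 G : R -> R,
            indefinite_integral I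
              (fun s => (ups1 s)^-1 *
                 (2 * kappa s / ups1 s
                    * (ups6 s - c1Dc2 / enorm c1 ^+ 2 * ups3 s) + 2)) G &
            forall s, I s -> h s = ups1 s * G s)
       & ((forall s, I s -> (entry (xt s) 1, entry (xt s) 2) != (0, 0)) ->
          exists r theta : R -> R,
          [/\ (forall s, I s ->
                 [/\ 0 < r s, entry (xt s) 1 = r s * cos (theta s)
                   & entry (xt s) 2 = r s * sin (theta s)]),
              (exists2 H : R -> R, indefinite_integral I h H &
                 forall s, I s -> r s ^+ 2 = H s - entry (xt s) 3 ^+ 2)
            & indefinite_integral I
                (fun s => (r s ^+ 2 * enorm c1)^-1
                   * (ups4 s - c1Dc2 / enorm c1 ^+ 2 * ups1 s)) theta])]) /\
  (* (ii) *)
  (forall beta c : R,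
     let c_1 := entry c1 1 in let c_2 := entry c1 2 in let c_3 := entry c1 3 in
     let c_4 := entry c2 1 in let c_5 := entry c2 2 in
     let root := Num.sqrt (enorm c1 ^+ 2 * cos beta ^+ 2 - c_3 ^+ 2) in
     let num := c_2 * c_3 * sin beta + c_1 * root in
     let den := c_1 * c_3 * sin beta - c_2 * root in
     c_3 != 0 -> 0 <= enorm c1 ^+ 2 * cos beta ^+ 2 - c_3 ^+ 2 -> den != 0 ->
     let alpha := - arctan (c_3 * cos beta < 0) (root / c_3) in
     let gamma := arctan (0 < den * cos beta) (num / den) in
     let a := c_1 / c_3 * c
              + (c_5 * enorm c1 ^+ 2 + c_2 * c1Dc2) / (c_3 * enorm c1 ^+ 2) in
     let b := c_2 / c_3 * c
              + (c_4 * enorm c1 ^+ 2 - c_1 * c1Dc2) / (c_3 * enorm c1 ^+ 2) in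
     exists xt : R -> 'cV[R]_3,
       transformed_curve I x c1 c2
         (euler_rotation alpha beta gamma) (vec3 a b c) xt).
Proof.
move=> ups1 ups3 ups4 ups6 kappa c1Dc2.
have n_gt0 : 0 < enorm c1 by rewrite lt_def enorm_eq0 c1_neq0 sqrtr_ge0.
have n0 := lt0r_neq0 n_gt0.
split; last first.
  move=> beta c c_1 c_2 c_3 c_4 c_5 root num den c30 disc_ge0 den0.
  move=> alpha gamma a b.
  set M := euler_rotation _ _ _.
  have rM : rotation M := euler_rotation_rotation _ _ _.
  (* The transformed curve is the image of x under the inverse motion. *)
  exists (fun s => M^T *m (x s - vec3 a b c)); split=> //; last first.
    by move=> s Is; case: rM => /mulmx1C oM _; rewrite mulmxA oM mul1mx subrK.
  have n2 : enorm c1 ^+ 2 = c_1 ^+ 2 + c_2 ^+ 2 + c_3 ^+ 2.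
    by rewrite enorm_sq dotE -!expr2.
  apply/normalizedP => //; split.
    rewrite euler_rotation_axis//.
    by apply: col3P; rewrite !entry_vec3.
  have DE : c1Dc2 = c_1 * c_4 - c_2 * c_5 + c_3 * entry c2 3.
    by rewrite /c1Dc2 dotE !entry_Dmx mulrN.
  (* The first two coordinates of the moment equation are solved by b and a. The third follows from
     mu n^2 = c1^T D c2. The value c is free since a translation along c1 does not change the
     moment. *)
  rewrite -/c1Dc2; apply: col3P;
    rewrite entryD entryZ entry_cross !entry_vec3 !entry_Dmx.
  - rewrite -/c_1 -/c_2 -/c_3 -/c_4 /b; field; exact/andP.
  - rewrite -/c_1 -/c_2 -/c_3 -/c_5 /a; field; exact/andP.
  - rewrite -/c_1 -/c_2 -/c_3.
    transitivity ((c_2 * c_5 - c_1 * c_4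
      + c1Dc2 / enorm c1 ^+ 2 * (c_1 ^+ 2 + c_2 ^+ 2 + c_3 ^+ 2)) / c_3).
      by rewrite /a /b; field; exact/andP.
    by rewrite -n2 divfK ?expf_neq0// DE; field.
move=> M a xt tc h.
set mu := c1Dc2 / enorm c1 ^+ 2.
have law s (Is : I s) := transformed_noether I_open x_smooth x_arclength
  c1_neq0 tc Is (x_curved s Is) (x_noether s Is).
have ent n k s : I s ->
    is_derive s 1 (fun u => entry (xt^`(n)%classic u) k)
      (entry (xt^`(n.+1)%classic s) k).
  by move=> Is; have [dn _] := transformed_derive n I_open x_smooth tc Is;
     exact: is_derive_entry.
have centry n k s : I s ->
    {for s, continuous (fun u => entry (xt^`(n)%classic u) k)}.
  by move=> /(ent n k); exact: is_derive_continuous.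
have hE s : I s -> is_derive s 1 (fun u => dot (xt u) (xt u))
   (2 * dot (xt s) (xt^`()%classic s)).
  move=> Is; have [dn _] := transformed_derive 0 I_open x_smooth tc Is.
  by apply: is_derive_eq (is_derive_dot dn dn) _; rewrite !dotE; ring.
split.
- exists (fun s => enorm c1 * entry (xt s) 3); last first.
    by move=> s Is; rewrite mulKf.
  (* Replacing the integrand by its expression through the derivatives of [xt] makes its continuity
     immediate, with no analysis of the Euler operators. *)
  apply: (@indefinite_integral_eq _ _ _
    (fun s => enorm c1 * entry (xt^`()%classic s) 3)) => //.
    by move=> s /set_mem Is; rewrite /ups1; have [-> _ _] := law s Is.
  apply: indefinite_integral_derive => // s Is.
    by have ? := ent 0%N 3 s Is; apply: is_derive_eq.
  by apply: cvgM; [exact: cvg_cst|exact: (centry 1%N)].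
- move=> ups1_neq0.
  pose w s := dot (xt s) (xt^`()%classic s).
  (* This is h / upsilon^(1), since h = 2 w and upsilon^(1) = n T_3. *)
  pose G s := 2 * w s * (enorm c1 * entry (xt^`()%classic s) 3)^-1.
  have T3 s : I s -> enorm c1 * entry (xt^`()%classic s) 3 != 0.
    move=> Is; have := ups1_neq0 s Is.
    by rewrite /ups1; have [-> _ _] := law s Is.
  have T30 s : I s -> entry (xt^`()%classic s) 3 != 0.
    by move=> /T3; rewrite mulf_eq0 negb_or => /andP[].
  pose B s := cross (xt^`()%classic s) (xt^`(2)%classic s).
  (* The derivative of [G]: writing y for [xt] and P for its second derivative, w' = 1 + y . P, and
     y_1 B_2 - y_2 B_1 is the third coordinate of y x (T x P) = (y . P) T - (y . T) P. *)
  pose g s := (enorm c1 * entry (xt^`()%classic s) 3)^-1 *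
    (2 * (entry (xt s) 1 * entry (B s) 2 - entry (xt s) 2 * entry (B s) 1)
       / entry (xt^`()%classic s) 3 + 2).
  exists G; last first.
    move=> s Is; rewrite /h derive1E; have [_ ->] := hE s Is.
    rewrite /ups1; have [-> _ _] := law s Is.
    by rewrite /G -/(w s) [RHS]mulrC divfK// T3.
  apply: (@indefinite_integral_eq _ _ _ g) => //.
    move=> s /set_mem Is; rewrite /g /ups1 /ups3 /ups6.
    have [-> _ law6] := law s Is; congr (_ * (_ + _)).
    have k0 := x_curved s Is.
    (* The curvature is grouped with upsilon^(6) - mu upsilon^(3) so that the third identity of
       [law] applies. *)
    transitivity (2 * (kappa s *
        (entry (upsilon L x s) 6 - mu * entry (upsilon L x s) 3))
      / (enorm c1 * entry (xt^`()%classic s) 3)).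
      rewrite law6 -/(B s); field; rewrite T30//.
    by field; rewrite T30.
  apply: indefinite_integral_derive => // s Is.
    have [d1 _] := transformed_derive 0 I_open x_smooth tc Is.
    have [d2 _] := transformed_derive 1 I_open x_smooth tc Is.
    have ? := is_derive_dot d1 d2.
    have ? := ent 1%N 3 s Is.
    have tt : dot (xt^`()%classic s) (xt^`()%classic s) = 1.
      have [_ /=] := transformed_derive 0 I_open x_smooth tc Is.
      rewrite -derive1E => ->; have [rM _ _] := tc.
      rewrite (dot_mulmx _ _ (rotation_tr rM)) -enorm_sq.
      by rewrite x_arclength// expr1n.
    have dn : is_derive s 1 (fun u => enorm c1 * entry (xt^`()%classic u) 3)
      (enorm c1 * entry (xt^`(2)%classic s) 3) by apply: is_derive_eq.
    have dw : is_derive s 1 (fun u => 2 * w u)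
        (2 * (1 + dot (xt s) (xt^`(2)%classic s))).
      by apply: is_derive_eq; rewrite tt.
    have ? := @is_deriveV _ (fun u => enorm c1 * entry (xt^`()%classic u) 3)
      s _ _ (T3 s Is) dn.
    apply: is_derive_eq.
    rewrite /GRing.scale /= /g /w /B !entry_cross !dotE; field.
    by rewrite n0 T30.
  have c0 k : {for s, continuous (fun u => entry (xt u) k)}.
    exact: (centry 0%N).
  have cT k : {for s, continuous (fun u => entry (xt^`()%classic u) k)}.
    exact: (centry 1%N).
  have cP k : {for s, continuous (fun u => entry (xt^`(2)%classic u) k)}.
    exact: (centry 2%N).
  have cB1 : {for s, continuous (fun u => entry (B u) 1)}.
    rewrite (_ : (fun u => _) = (fun u =>
        entry (xt^`()%classic u) 2 * entry (xt^`(2)%classic u) 3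
        - entry (xt^`()%classic u) 3 * entry (xt^`(2)%classic u) 2)); last first.
      by apply/funext => u; rewrite entry_cross.
    by apply: cvgB; apply: cvgM; [exact: cT|exact: cP|exact: cT|exact: cP].
  have cB2 : {for s, continuous (fun u => entry (B u) 2)}.
    rewrite (_ : (fun u => _) = (fun u =>
        entry (xt^`()%classic u) 3 * entry (xt^`(2)%classic u) 1
        - entry (xt^`()%classic u) 1 * entry (xt^`(2)%classic u) 3)); last first.
      by apply/funext => u; rewrite entry_cross.
    by apply: cvgB; apply: cvgM; [exact: cT|exact: cP|exact: cT|exact: cP].
  apply: cvgM.
    by apply: cvgV; [exact: T3|apply: cvgM; [exact: cvg_cst|exact: cT]].
  apply: cvgD; last exact: cvg_cst.
  apply: cvgM; last by apply: cvgV; [exact: T30|exact: cT].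
  apply: cvgM; first exact: cvg_cst.
  by apply: cvgB; apply: cvgM; [exact: c0|exact: cB2|exact: c0|exact: cB1].
- move=> xy0.
  have rho_gt0 s : I s -> 0 < entry (xt s) 1 ^+ 2 + entry (xt s) 2 ^+ 2.
    move=> Is; rewrite lt_def addr_ge0 ?sqr_ge0// andbT.
    apply: contra (xy0 s Is); rewrite paddr_eq0 ?sqr_ge0// !sqrf_eq0.
    by move=> /andP[/eqP-> /eqP->].
  have [theta [XY itheta]] := polar_lift I_interval I_open
    (ent 0%N 1) (ent 0%N 2) (centry 1%N 1) (centry 1%N 2) rho_gt0.
  have r2 s : I s -> Num.sqrt (entry (xt s) 1 ^+ 2 + entry (xt s) 2 ^+ 2) ^+ 2
      = entry (xt s) 1 ^+ 2 + entry (xt s) 2 ^+ 2.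
    by move=> Is; rewrite sqr_sqrtr// ltW// rho_gt0.
  exists (fun s => Num.sqrt (entry (xt s) 1 ^+ 2 + entry (xt s) 2 ^+ 2)), theta.
  split.
  + by move=> s Is; have [XE YE] := XY s Is; rewrite sqrtr_gt0 rho_gt0.
  (* Subtracting the square of the third coordinate from this primitive of h leaves r^2. *)
  + exists (fun s => dot (xt s) (xt s)).
      apply: (@indefinite_integral_eq _ _ _
        (fun s => 2 * dot (xt s) (xt^`()%classic s))) => //.
        move=> s /set_mem Is.
        by rewrite /h [RHS]derive1E; have [_ ->] := hE s Is.
      apply: indefinite_integral_derive => // s Is.
      apply: cvgM; first exact: cvg_cst.
      have [d1 _] := transformed_derive 0 I_open x_smooth tc Is.
      have [d2 _] := transformed_derive 1 I_open x_smooth tc Is.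
      exact: is_derive_continuous (is_derive_dot d1 d2).
    by move=> s Is; rewrite r2// dotE -!expr2; ring.
  + apply: indefinite_integral_eq itheta => // s /set_mem Is.
    have [_ law4 _] := law s Is.
    (* The numerator of the angular speed equals (upsilon^(4) - mu upsilon^(1)) / n. *)
    have := rho_gt0 s Is; rewrite r2// /ups4 /ups1 law4 => /lt0r_neq0 rho0.
    by field; rewrite n0.
Qed.
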